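(* Let $\phi:[0,\infty)\to\mathbb{R}$ be finite, convex, and nondecreasing, with $L:=\lim_{r\to\infty}\phi(r)/r\in(0,\infty)$. Assume that $\gamma:=\lim_{r\to\infty}(\phi(r)-Lr)$ is finite and that $\phi(r)-Lr\neq\gamma$ for every $r\ge0$, and set $d(r)=\phi(r)-Lr-\gamma>0$. Assume that for some $\nu>0$ and $\kappa>0$, $$d(r)\sim\kappa r^{-\nu}\qquad(r\to\infty).$$ Fix $a>0$ and, for $\mu>0$, let $$G_\mu(r)=a\phi(r)-(aL-\mu)r=a\gamma+a\,d(r)+\mu r,\qquad r\ge0.$$ Let $r_\mu$ be any minimizer of $G_\mu$ over $[0,\infty)$. Then, as $\mu\downarrow0$, $$r_\mu\sim\left(\frac{a\nu\kappa}{\mu}\right)^{1/(\nu+1)},$$ $$\min_{r\ge0}G_\mu(r)-a\gamma\sim C_\nu(a\kappa)^{1/(\nu+1)}\mu^{\nu/(\nu+1)},$$ $$a\,d(r_\mu)\sim\nu^{-\nu/(\nu+1)}(a\kappa)^{1/(\nu+1)}\mu^{\nu/(\nu+1)},$$ where $C_\nu=(\nu+1)\nu^{-\nu/(\nu+1)}$. Every family of minimizers has the same asymptotic radius.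
   Context: $A\sim B$ means that the ratio $A/B$ tends to $1$ in the indicated limit. *)

(* Defs.v *)
From HB Require Import structures.
From mathcomp Require Import all_boot all_order all_algebra.
From mathcomp Require Import all_classical all_reals all_analysis.
From mathcomp Require Import ring.

Set Implicit Arguments.
Unset Strict Implicit.
Unset Printing Implicit Defensive.

Import Order.TTheory GRing.Theory Num.Theory.
Import numFieldNormedType.Exports.

Local Open Scope classical_set_scope.
Local Open Scope ring_scope.

(* Ratio asymptotics.  As x / 0 = 0, this forces g to be eventually nonzero
   along F. *)
Definition asymp_equiv (R : realType) (T : Type) (F : set_system T)
    (f g : T -> R) : Prop :=
  f t / g t @[t --> F] --> (1 : R).

Definition is_minimizer (R : realType) (A : set R) (f : R -> R) (r : R) : Prop :=
  A r /\ forall s, A s -> f r <= f s.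

(* This is the minimum of f over A as soon as it is attained, see
   [min_valueE]. *)
Definition min_value (R : realType) (A : set R) (f : R -> R) : R := inf (f @` A).

Lemma min_valueE (R : realType) (A : set R) (f : R -> R) (r : R) :
  is_minimizer A f r -> min_value A f = f r.
Proof.
move=> [Ar fr]; rewrite /min_value; apply/eqP; rewrite eq_le; apply/andP; split.
  by apply: ge_inf; [exists (f r) => _ [s As <-]; exact: fr | exists r].
by apply: lb_le_inf; [exists (f r), r | move=> _ [s As <-]; exact: fr].
Qed.

(* [0, +oo[.  Functions on it are represented by total functions R -> R whose
   values at negative arguments are irrelevant. *)
Definition halfline (R : realType) : set R := [set` `[0, +oo[].
Arguments halfline : clear implicits.

Definition defect (R : realType) (phi : R -> R) (L gamma r : R) : R :=
  phi r - L * r - gamma.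

Definition tilted (R : realType) (phi : R -> R) (L a mu r : R) : R :=
  a * phi r - (a * L - mu) * r.

Lemma tiltedE (R : realType) (phi : R -> R) (L gamma a mu r : R) :
  tilted phi L a mu r = a * gamma + a * defect phi L gamma r + mu * r.
Proof. by rewrite /tilted /defect; ring. Qed.

Definition minimizer_family (R : realType) (phi : R -> R) (L a : R)
    (rmin : R -> R) : Prop :=
  forall mu, 0 < mu -> is_minimizer (halfline R) (tilted phi L a mu) (rmin mu).

Definition Cnu (R : realType) (nu : R) : R :=
  (nu + 1) * nu `^ (- (nu / (nu + 1))).

(* Main.v *)
(* Let s = (a nu kappa / mu)^(1/(nu+1)).  Measuring radii in units of s and
   energies in units of mu s, the convex functions G_mu - a gamma converge
   pointwise to F(x) = x^(-nu) / nu + x, whose strict minimum on ]0, +oo[ is at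
   x = 1.  Comparing the values at 1 - e, 1 and 1 + e, convexity traps every
   minimizer of G_mu between (1 - e) s and (1 + e) s, so r_mu ~ s.  Hence
   r_mu -> +oo, and the asymptotics of d at r_mu give the other two limits.

   Minimizers exist because d is nonincreasing (a convex function with a finite
   limit at +oo), so the nondecreasing function phi is L-Lipschitz, in
   particular continuous at 0. *)
Require Import Defs.
From HB Require Import structures.
From mathcomp Require Import all_boot all_order all_algebra.
From mathcomp Require Import all_classical all_reals all_analysis.
From mathcomp Require Import ring lra.

Set Implicit Arguments.
Unset Strict Implicit.
Unset Printing Implicit Defensive.

Import Order.TTheory GRing.Theory Num.Theory.
Import numFieldNormedType.Exports.

Local Open Scope classical_set_scope.
Local Open Scope ring_scope.

(** * Convexity on the half-line *)

Lemma halflineE (R : realType) (x : R) : halfline R x = (0 <= x) :> Prop.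
Proof. by rewrite /halfline /= in_itv /= andbT. Qed.

(** Convexity with weight [(z - y) / (z - x)] at [x], cleared of denominators so that it also covers
    [x = z] and suits linear arithmetic. *)
Lemma convex_function_chord (R : realType) (f : R -> R) (x y z : R) :
  convex_function (halfline R : set (convex_lmodType R^o)) f ->
  0 <= x -> x <= y -> y <= z ->
  (z - x) * f y <= (z - y) * f x + (y - x) * f z.
Proof.
move=> fc x0 xy yz; have [xz|zx] := ltP x z; last first.
  have -> : z = x by lra.
  have -> : y = x by lra.
  by rewrite !subrr !mul0r addr0.
have zx0 : 0 < z - x by lra.
have t01 : Itv.spec (@Itv.num_sem R) (Itv.Real `[0%Z, 1%Z]) ((z - y) / (z - x)).
  rewrite /= /Itv.num_sem /= num_real in_itv/= divr_ge0 ?ler_pdivrMr//; lra.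
have := fc (Itv.mk t01) x z.
rewrite !inE !halflineE => /(_ x0 ltac:(lra)).
rewrite [X in f X]convRE !convRE /unstable.onem /=.
set t := (z - y) / (z - x).
have -> : t * x + (1 - t) * z = y by rewrite /t; field; lra.
move=> /(ler_wpM2l (ltW zx0)) /le_trans; apply.
by rewrite le_eqVlt; apply/orP; left; apply/eqP; rewrite /t; field; lra.
Qed.

Lemma convex_function_affine (R : realType) (f : R -> R) (a b c : R) :
  0 <= a -> convex_function (halfline R : set (convex_lmodType R^o)) f ->
  convex_function (halfline R : set (convex_lmodType R^o))
    (fun x : R => a * f x + b * x + c).
Proof.
move=> a0 fc t x y xD yD; have := fc t x y xD yD.
rewrite ![conv t x y]convRE !convRE /unstable.onem /=.
set u := t%:num; set v := f _ => /(ler_wpM2l a0) h.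
apply: (@le_trans _ _ (a * (u * f x + (1 - u) * f y)
  + b * (u * x + (1 - u) * y) + c)).
  by rewrite !lerD2r.
by rewrite le_eqVlt; apply/orP; left; apply/eqP; ring.
Qed.

(** A strict increase from [x] to [y] would force growth at least linear beyond [y], against the
    finite limit. *)
Lemma convex_cvg_nonincr (R : realType) (f : R -> R) (l : R) :
  convex_function (halfline R : set (convex_lmodType R^o)) f ->
  f x @[x --> +oo] --> l -> forall x y, 0 <= x -> x <= y -> f y <= f x.
Proof.
move=> fc fl x y x0 xy; rewrite leNgt; apply/negP => fxy.
have {}xy : x < y.
  by rewrite lt_neqAle xy andbT; apply: contraTneq fxy => ->; rewrite ltxx.
(* Past this threshold the line through the points at [x] and [y] has risen by more than
   [|l| + 1 + |f x|] above [f x], hence lies above [l + 1]. *)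
have [z [yz fz hz]] : exists z, [/\ y <= z, f z < l + 1 &
    x + (y - x) * (`|l| + 1 + `|f x|) / (f y - f x) < z].
  near (+oo%R : set_system R) => z; exists z; split.
  - by near: z; apply: nbhs_pinfty_ge; exact: num_real.
  - by near: z; apply: (cvgr_lt _ fl); rewrite ltrDl.
  - by near: z; apply: nbhs_pinfty_gt; exact: num_real.
have h := convex_function_chord fc x0 (ltW xy) yz.
have d0 : 0 < f y - f x by lra.
move: hz; rewrite -ltrBrDl ltr_pdivrMr// => hz.
have : (y - x) * f z < (y - x) * (l + 1) by rewrite ltr_pM2l //; lra.
have : (y - x) * (l - f x) <= (y - x) * (`|l| + `|f x|).
  rewrite ler_pM2l; last lra.
  by have := ler_norm l; have := ler_norm (- f x); rewrite normrN; lra.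
nra.
Unshelve. all: by end_near. Qed.

(** If [r <= u], then [u] lies between [r] and [c], where [f] is at most [f c] by convexity,
    contradicting [f c < f u]; likewise for [v]. *)
Lemma convex_minimizer_between (R : realType) (f : R -> R) (u c v r : R) :
  convex_function (halfline R : set (convex_lmodType R^o)) f ->
  0 <= u -> u < c -> c < v -> f c < f u -> f c < f v ->
  is_minimizer (halfline R) f r -> u < r < v.
Proof.
move=> fc u0 uc cv fu fv [r0 rmin].
have {r0} r0 : 0 <= r by rewrite -halflineE.
have frc : f r <= f c by apply: rmin; rewrite halflineE; lra.
apply/andP; split; rewrite ltNge; apply/negP => h.
  have := convex_function_chord fc r0 h (ltW uc).
  have := ler_wpM2l (_ : 0 <= c - u) frc; rewrite subr_ge0 => /(_ (ltW uc)).
  have : (c - r) * f c < (c - r) * f u by rewrite ltr_pM2l //; lra.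
  lra.
have := convex_function_chord fc (_ : 0 <= c) (ltW cv) h.
have := ler_wpM2l (_ : 0 <= v - c) frc; rewrite subr_ge0 => /(_ (ltW cv)).
have : (r - c) * f c < (r - c) * f v by rewrite ltr_pM2l //; lra.
move=> h1 h2 /(_ ltac:(lra)); lra.
Qed.

(** * Ratio asymptotics and power laws *)

Lemma powR_continuous (R : realType) (p x : R) :
  0 < x -> {for x, continuous (fun y : R => y `^ p)}.
Proof.
move=> x0; apply/differentiable_continuous/derivable1_diffP.
by apply: derivable_powR; rewrite in_itv/= x0.
Qed.

Lemma asymp_equiv_of_ratio (R : realType) (T : Type) (F : set_system T)
    (FF : Filter F) (f g h : T -> R) (l : R) :
  l != 0 -> f t / g t @[t --> F] --> l -> {near F, h =1 (fun t => l * g t)} ->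
  asymp_equiv F f h.
Proof.
move=> l0 fg hE; rewrite /asymp_equiv -[X in _ --> X](mulVf l0).
apply: cvg_trans (cvgMl_tmp (a := l^-1) fg); apply: near_eq_cvg.
by apply: filterS hE => t /= ->; rewrite invfM mulrCA.
Qed.

(** The power of [xi t * s t] factors and [s t] cancels. The factor [xi] may vary, so that
    minimizers are covered as well as fixed multiples of the scale. *)
Lemma asymp_equiv_powR_rescale (R : realType) (T : Type) (F : set_system T)
    (FF : Filter F) (f : R -> R) (nu kappa x : R) (s xi : T -> R) :
  0 < kappa -> 0 < x ->
  asymp_equiv +oo f (fun r : R => kappa * r `^ (- nu)) ->
  s t @[t --> F] --> +oo -> xi t @[t --> F] --> x ->
  f (xi t * s t) / (kappa * s t `^ (- nu)) @[t --> F] --> x `^ (- nu).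
Proof.
move=> k0 x0 fk soo xix.
have sp : \forall t \near F, 0 < s t by exact: (cvgry_gt soo).
(* Staying above [x / 2] ensures that [xi t * s t] still diverges. *)
have xip : \forall t \near F, x / 2 < xi t by apply: (cvgr_gt _ xix); lra.
have xsoo : xi t * s t @[t --> F] --> +oo.
  apply/cvgryPgt => A; have As := @cvgry_gt _ _ _ FF _ soo (A / (x / 2)).
  near=> t.
  apply: (@lt_trans _ _ (x / 2 * s t)); last first.
    by rewrite ltr_pM2r; near: t.
  by rewrite [ltRHS]mulrC -ltr_pdivrMr ?divr_gt0//; near: t.
have h1 := cvg_comp _ _ xsoo fk.
have h2 := cvg_comp _ _ xix (@powR_continuous _ (- nu) _ x0).
rewrite -[X in _ --> X]mul1r.
apply: cvg_trans (cvgM h1 h2); apply: near_eq_cvg; near=> t => /=.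
have s0 : 0 < s t by near: t.
have xi0 : 0 < xi t by apply: lt_trans (_ : x / 2 < xi t); [lra|near: t].
rewrite powRM ?ltW//.
have := powR_gt0 (- nu) s0; have := powR_gt0 (- nu) xi0.
by move=> A B; field; rewrite !gt_eqF.
Unshelve. all: by end_near. Qed.

(** * The limit profile and the radius scale *)

(** The strict bound [1 + y < expR y] is used at [y = ln x] and at [y = - nu * ln x]; the logarithms
    cancel in the sum. *)
Lemma power_profile_min (R : realType) (nu x : R) :
  0 < nu -> 0 < x -> x != 1 -> nu^-1 + 1 < x `^ (- nu) / nu + x.
Proof.
move=> nu0 x0 x1.
have lnx : ln x != 0 by rewrite ln_eq0.
have h1 : 1 + ln x < x by have := expR_gt1Dx lnx; rewrite lnK.
have h2 : 1 - nu * ln x < x `^ (- nu).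
  rewrite /powR gt_eqF// -mulNr.
  by apply: expR_gt1Dx; rewrite mulf_neq0// oppr_eq0 gt_eqF.
apply: (@lt_trans _ _ ((1 - nu * ln x) / nu + x)).
  have -> : (1 - nu * ln x) / nu = nu^-1 - ln x by field; rewrite gt_eqF.
  by lra.
by rewrite ltrD2r ltr_pM2r ?invr_gt0.
Qed.

(* With c = a nu kappa, this is the critical point of
   r |-> a kappa r^(-nu) + mu r. *)
Definition radius_scale (R : realType) (nu c mu : R) : R :=
  (c / mu) `^ (1 / (nu + 1)).

Lemma radius_scale_cvgy (R : realType) (nu c : R) : 0 < nu -> 0 < c ->
  radius_scale nu c mu @[mu --> 0^'+] --> +oo.
Proof.
move=> nu0 c0; apply/cvgryPgt => A.
(* A positive bound is needed to take the power [nu + 1] and divide by it. *)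
pose B := Num.max A 1.
have B0 : 0 < B by rewrite lt_max ltr01 orbT.
have n0 : 0 < nu + 1 by lra.
near=> mu.
have mu0 : 0 < mu by near: mu; exact: nbhs_right_gt.
have hmu : mu < c / B `^ (nu + 1).
  by near: mu; apply: nbhs_right_lt; rewrite divr_gt0 ?powR_gt0.
apply: (@le_lt_trans _ _ B); first by rewrite le_max lexx.
rewrite -[ltLHS]powRr1 ?ltW// -[X in _ `^ X](_ : (nu + 1) * (1 / (nu + 1)) = 1).
  rewrite powRrM; apply: gt0_ltr_powR; rewrite ?divr_gt0// ?nnegrE ?powR_ge0//.
    by rewrite divr_ge0 ?ltW.
  by rewrite ltr_pdivlMr// mulrC -ltr_pdivlMr ?powR_gt0.
by field; lra.
Unshelve. all: by end_near. Qed.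

(** The critical point equation [s ^ (nu + 1) = c / mu], rearranged to convert the size of the
    defect into the energy unit [mu * s]. *)
Lemma radius_scale_balance (R : realType) (nu c mu : R) :
  0 < nu -> 0 < c -> 0 < mu ->
  c * radius_scale nu c mu `^ (- nu) = mu * radius_scale nu c mu.
Proof.
move=> nu0 c0 mu0; set s := radius_scale nu c mu.
have s0 : 0 < s by rewrite powR_gt0 ?divr_gt0.
have sE : s `^ (nu + 1) = c / mu.
  rewrite /s /radius_scale -powRrM.
  have -> : 1 / (nu + 1) * (nu + 1) = 1 by field; lra.
  by rewrite powRr1// divr_ge0 ?ltW.
have sE' : s = c / mu * s `^ (- nu).
  rewrite -sE -powRD; last by rewrite (gt_eqF s0) implybT.
  by rewrite addrAC subrr add0r powRr1 ?ltW.
by rewrite [in RHS]sE'; field; rewrite gt_eqF.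
Qed.

Lemma mul_radius_scale (R : realType) (nu c mu : R) :
  0 < nu -> 0 < c -> 0 < mu ->
  mu * radius_scale nu c mu = c `^ (1 / (nu + 1)) * mu `^ (nu / (nu + 1)).
Proof.
move=> nu0 c0 mu0; rewrite /radius_scale powRM ?invr_ge0 ?ltW// mulrCA.
congr (_ * _); rewrite -powR_inv1 ?ltW// -powRrM.
rewrite -{1}[mu]powRr1 ?ltW// -powRD; last by rewrite (gt_eqF mu0) implybT.
by congr (_ `^ _); field; lra.
Qed.

(** Splitting [nu] off [a * nu * kappa] leaves the exponent identity
    [- nu / (nu + 1) = -1 + 1 / (nu + 1)]. *)
Lemma radius_scale_constant (R : realType) (nu a kappa mu : R) :
  0 < nu -> 0 < a -> 0 < kappa -> 0 < mu ->
  nu `^ (- (nu / (nu + 1))) * (a * kappa) `^ (1 / (nu + 1))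
    * mu `^ (nu / (nu + 1)) =
  nu^-1 * (mu * radius_scale nu (a * nu * kappa) mu).
Proof.
move=> nu0 a0 k0 mu0; rewrite mul_radius_scale ?mulr_gt0//.
rewrite (_ : a * nu * kappa = nu * (a * kappa)); last by ring.
rewrite (powRM _ (ltW nu0)) ?mulr_ge0 ?ltW// !mulrA; congr (_ * _ * _).
rewrite -(powR_inv1 (ltW nu0)) -powRD ?(gt_eqF nu0) ?implybT//.
by congr (_ `^ _); field; lra.
Qed.

(** * Existence of minimizers and sign of the defect *)

Lemma lipschitz_minimizer_exists (R : realType) (f : R -> R) (K M : R) :
  (forall x y, 0 <= x -> x <= y -> `|f x - f y| <= K * (y - x)) ->
  0 <= M -> (forall r, M <= r -> f 0 <= f r) ->
  exists r, is_minimizer (halfline R) f r.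
Proof.
move=> fK M0 fM.
(* Values of [f] at negative arguments are arbitrary; freezing them at [f 0] gives a function
   continuous on the whole line. *)
pose g x := f (Num.max 0 x).
have gK x y : x <= y -> `|g x - g y| <= `|K| * `|x - y|.
  move=> xy; have m0 : 0 <= Num.max 0 x by rewrite le_max lexx.
  have mxy : Num.max 0 x <= Num.max 0 y.
    by rewrite ge_max !le_max lexx xy orbT.
  apply: (le_trans (fK _ _ m0 mxy)).
  apply: (@le_trans _ _ (`|K| * (Num.max 0 y - Num.max 0 x))).
    by rewrite ler_wpM2r ?subr_ge0// ler_norm.
  rewrite ler_wpM2l// distrC (ger0_norm (_ : 0 <= y - x)) ?subr_ge0//.
  by case: (leP 0 x); case: (leP 0 y); lra.
have {}gK x y : `|g x - g y| <= `|K| * `|x - y|.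
  have [/gK//|/ltW/gK] := leP x y.
  by rewrite distrC [in X in _ <= X]distrC.
have gcont : continuous g.
  move=> x; apply/cvgrPdist_le => e e0; near=> y.
  apply: (le_trans (gK _ _)).
  (* The extra 1 keeps the divisor positive when [K = 0]. *)
  apply: (@le_trans _ _ ((`|K| + 1) * `|x - y|)).
    by rewrite ler_wpM2r// lerDl.
  rewrite mulrC -ler_pdivlMr ?ltr_wpDl//.
  by near: y; apply: cvgr_dist_le; rewrite ?divr_gt0 ?ltr_wpDl//; exact: cvg_id.
have [c] := EVT_min M0 (continuous_subspaceT gcont).
rewrite in_itv/= => /andP[c0 cM] gmin.
have gE x : 0 <= x -> g x = f x by move=> x0; rewrite /g max_r.
exists c; split=> [|r]; rewrite !halflineE// => r0.
have [rM|Mr] := leP r M.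
  by rewrite -gE// -(gE r)//; apply: gmin; rewrite in_itv/= r0 rM.
apply: (@le_trans _ _ (f 0)); last exact/fM/ltW.
by rewrite -gE// -(gE 0)//; apply: gmin; rewrite in_itv/= lexx M0.
Unshelve. all: by end_near. Qed.

Lemma convex_tilted (R : realType) (phi : R -> R) (L a mu : R) :
  0 <= a -> convex_function (halfline R : set (convex_lmodType R^o)) phi ->
  convex_function (halfline R : set (convex_lmodType R^o)) (tilted phi L a mu).
Proof.
move=> a0 fc; rewrite (_ : tilted _ _ _ _ =
    (fun x : R => a * phi x + (- (a * L - mu)) * x + 0)).
  exact: convex_function_affine.
by apply/funext => r; rewrite /tilted addr0 mulNr.
Qed.

Lemma convex_defect (R : realType) (phi : R -> R) (L gamma : R) :
  convex_function (halfline R : set (convex_lmodType R^o)) phi ->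
  convex_function (halfline R : set (convex_lmodType R^o)) (defect phi L gamma).
Proof.
move=> fc; rewrite (_ : defect _ _ _ =
    (fun x : R => 1 * phi x + (- L) * x + (- gamma))).
  exact: convex_function_affine.
by apply/funext => r; rewrite /defect mul1r mulNr.
Qed.

Lemma defect_nonincr (R : realType) (phi : R -> R) (L gamma : R) :
  convex_function (halfline R : set (convex_lmodType R^o)) phi ->
  phi r - L * r @[r --> +oo] --> gamma ->
  forall x y, 0 <= x -> x <= y ->
    defect phi L gamma y <= defect phi L gamma x.
Proof.
move=> fc fg; apply: (@convex_cvg_nonincr _ _ (gamma - gamma)).
  exact: convex_defect.
by apply: cvgB => //; exact: cvg_cst.
Qed.

(** A nonincreasing function with limit 0 is nonnegative, and [phi_neq] in the final theorem
    supplies the exclusion of 0. *)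
Lemma defect_gt0 (R : realType) (phi : R -> R) (L gamma : R) :
  convex_function (halfline R : set (convex_lmodType R^o)) phi ->
  phi r - L * r @[r --> +oo] --> gamma ->
  (forall r : R, 0 <= r -> phi r - L * r <> gamma) ->
  forall r : R, 0 <= r -> 0 < defect phi L gamma r.
Proof.
move=> fc fg fn r r0; rewrite lt_neqAle; apply/andP; split.
  by apply/eqP => h; apply: (fn r r0); move: h; rewrite /defect; lra.
rewrite leNgt; apply/negP => dr.
have [z [rz hz]] : exists z,
    r <= z /\ gamma + defect phi L gamma r < phi z - L * z.
  near (+oo%R : set_system R) => z; exists z; split.
    by near: z; apply: nbhs_pinfty_ge; exact: num_real.
  by near: z; apply: (cvgr_gt _ fg); rewrite gtrDl.
have := defect_nonincr fc fg r0 rz; move: hz; rewrite /defect; lra.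
Unshelve. all: by end_near. Qed.

(** * Asymptotics along minimizers *)

Section Asymptotics.
Variables (R : realType) (phi : R -> R) (L gamma nu kappa a : R).
Hypothesis phi_convex :
  convex_function (halfline R : set (convex_lmodType R^o)) phi.
Hypothesis nu_gt0 : 0 < nu.
Hypothesis kappa_gt0 : 0 < kappa.
Hypothesis a_gt0 : 0 < a.
Hypothesis d_asymp : asymp_equiv +oo (defect phi L gamma)
  (fun r : R => kappa * r `^ (- nu)).

Let c_gt0 : 0 < a * nu * kappa. Proof. by rewrite !mulr_gt0. Qed.
Let s := radius_scale nu (a * nu * kappa).
Let s_gt0 (mu : R) : 0 < mu -> 0 < s mu.
Proof. by move=> mu0; rewrite powR_gt0 ?divr_gt0. Qed.

Lemma defect_rescaled_cvg (xi : R -> R) (x : R) :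
  0 < x -> xi mu @[mu --> 0^'+] --> x ->
  a * defect phi L gamma (xi mu * s mu) / (mu * s mu) @[mu --> 0^'+]
    --> x `^ (- nu) / nu.
Proof.
move=> x0 xix.
have h := asymp_equiv_powR_rescale (at_right_proper_filter _) kappa_gt0 x0
  d_asymp (radius_scale_cvgy nu_gt0 c_gt0) xix.
apply: cvg_trans (cvgMr_tmp (b := nu^-1) h);
  apply: near_eq_cvg; near=> mu => /=.
have mu0 : 0 < mu by near: mu; exact: nbhs_right_gt.
(* The unit [mu * s mu] becomes [a * nu * kappa * s mu ^ (- nu)], which accounts for the factor
   [nu^-1]. *)
rewrite -/(s mu) -(radius_scale_balance nu_gt0 c_gt0 mu0) -/(s mu).
have := powR_gt0 (- nu) (s_gt0 mu0) => p0.
by field; rewrite !gt_eqF.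
Unshelve. all: by end_near. Qed.

(* [tilted - a gamma] in units of mu s(mu), at radius x s(mu). *)
Let excess mu x :=
  (a * defect phi L gamma (x * s mu) + mu * (x * s mu)) / (mu * s mu).

Let excess_cvg (x : R) : 0 < x ->
  excess mu x @[mu --> 0^'+] --> x `^ (- nu) / nu + x.
Proof.
move=> x0.
have xx : (fun=> x : R) mu @[mu --> (0 : R)^'+] --> x by exact: cvg_cst.
apply: cvg_trans (cvgD (defect_rescaled_cvg x0 xx) xx);
  apply: near_eq_cvg; near=> mu => /=.
have mu0 : 0 < mu by near: mu; exact: nbhs_right_gt.
have sm0 := s_gt0 mu0.
by rewrite /excess !fctE; field; rewrite !gt_eqF.
Unshelve. all: by end_near. Qed.

(** The rescaled difference tends to the gap between the limit profile at [x] and its minimum at 1,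
    which is positive. *)
Let tilted_lt (x : R) : 0 < x -> x != 1 ->
  \forall mu \near 0^'+,
    tilted phi L a mu (s mu) < tilted phi L a mu (x * s mu).
Proof.
move=> x0 x1.
have h : excess mu x - excess mu 1 @[mu --> 0^'+] -->
    x `^ (- nu) / nu + x - (1 `^ (- nu) / nu + 1).
  exact: (cvgB (excess_cvg x0) (excess_cvg ltr01)).
have hlt : 0 < x `^ (- nu) / nu + x - (1 `^ (- nu) / nu + 1).
  by rewrite powR1 div1r subr_gt0; exact: power_profile_min.
have hnear : \forall mu \near 0^'+, 0 < excess mu x - excess mu 1.
  exact: (cvgr_gt _ h).
near=> mu.
have mu0 : 0 < mu by near: mu; exact: nbhs_right_gt.
have sm0 := s_gt0 mu0.
have : 0 < (excess mu x - excess mu 1) * (mu * s mu).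
  by rewrite pmulr_lgt0 ?mulr_gt0//; near: mu.
rewrite !(tiltedE _ _ gamma) /excess mulrBl !divfK ?mulf_neq0 ?gt_eqF//.
by rewrite !mul1r; lra.
Unshelve. all: by end_near. Qed.

Lemma minimizer_scaled_cvg (rmin : R -> R) :
  minimizer_family phi L a rmin -> asymp_equiv 0^'+ rmin s.
Proof.
move=> rP; apply/cvgrPdist_le => e e0.
(* The cap 1/2 keeps the left comparison radius [(1 - e') * s mu] positive. *)
pose e' := Num.min e (1 / 2).
have e'0 : 0 < e' by rewrite lt_min e0; lra.
have e'e : e' <= e by rewrite ge_min lexx.
have e'1 : e' <= 1 / 2 by rewrite ge_min lexx orbT.
have hu := @tilted_lt (1 - e') ltac:(lra) ltac:(lra).
have hv := @tilted_lt (1 + e') ltac:(lra) ltac:(lra).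
near=> mu.
have mu0 : 0 < mu by near: mu; exact: nbhs_right_gt.
have sm0 := s_gt0 mu0.
have /andP[] : (1 - e') * s mu < rmin mu < (1 + e') * s mu.
  apply: (convex_minimizer_between (c := s mu)
    (convex_tilted L mu (ltW a_gt0) phi_convex)).
  - by rewrite mulr_ge0 ?ltW//; lra.
  - by rewrite gtr_pMl//; lra.
  - by rewrite ltr_pMl//; lra.
  - by near: mu.
  - by near: mu.
  - exact: rP.
rewrite -ltr_pdivlMr// => h1; rewrite -ltr_pdivrMr// => h2.
by rewrite ler_norml; lra.
Unshelve. all: by end_near. Qed.

(** Rescaling applies with the varying factor [rmin mu / s mu], which tends to 1. *)
Lemma minimizer_defect_cvg (rmin : R -> R) :
  minimizer_family phi L a rmin ->
  a * defect phi L gamma (rmin mu) / (mu * s mu) @[mu --> 0^'+] --> nu^-1.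
Proof.
move=> rP; have := defect_rescaled_cvg ltr01 (minimizer_scaled_cvg rP).
rewrite powR1 div1r; apply: cvg_trans;
  apply: near_eq_cvg; near=> mu => /=.
have mu0 : 0 < mu by near: mu; exact: nbhs_right_gt.
by rewrite divfK// gt_eqF// s_gt0.
Unshelve. all: by end_near. Qed.

Lemma minimizer_value_cvg (rmin : R -> R) :
  minimizer_family phi L a rmin ->
  (min_value (halfline R) (tilted phi L a mu) - a * gamma) / (mu * s mu)
    @[mu --> 0^'+] --> nu^-1 + 1.
Proof.
move=> rP.
apply: cvg_trans (cvgD (minimizer_defect_cvg rP) (minimizer_scaled_cvg rP));
  apply: near_eq_cvg; near=> mu => /=.
have mu0 : 0 < mu by near: mu; exact: nbhs_right_gt.
rewrite !fctE (min_valueE (rP mu mu0)) (tiltedE _ _ gamma).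
by have sm0 := s_gt0 mu0; field; rewrite !gt_eqF.
Unshelve. all: by end_near. Qed.

End Asymptotics.

Theorem theorem6p2 (R : realType) (phi : R -> R) (L gamma nu kappa a : R)
  (phi_convex : convex_function (halfline R : set (convex_lmodType R^o)) phi)
  (phi_nondecr : {in halfline R &, {homo phi : x y / x <= y}})
  (phi_slope : phi r / r @[r --> +oo] --> L)
  (L_gt0 : 0 < L)
  (phi_gamma : phi r - L * r @[r --> +oo] --> gamma)
  (phi_neq : forall r : R, 0 <= r -> phi r - L * r <> gamma)
  (nu_gt0 : 0 < nu)
  (kappa_gt0 : 0 < kappa)
  (d_asymp : asymp_equiv +oo (defect phi L gamma)
               (fun r : R => kappa * r `^ (- nu)))
  (a_gt0 : 0 < a) :
  (forall r : R, 0 <= r -> 0 < defect phi L gamma r) /\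
  (forall mu : R, 0 < mu ->
     exists r : R, is_minimizer (halfline R) (tilted phi L a mu) r) /\
  (forall rmin : R -> R, minimizer_family phi L a rmin ->
     asymp_equiv 0^'+ rmin
       (fun mu : R => (a * nu * kappa / mu) `^ (1 / (nu + 1))) /\
     asymp_equiv 0^'+
       (fun mu : R => min_value (halfline R) (tilted phi L a mu) - a * gamma)
       (fun mu : R => Cnu nu * (a * kappa) `^ (1 / (nu + 1))
                        * mu `^ (nu / (nu + 1))) /\
     asymp_equiv 0^'+
       (fun mu : R => a * defect phi L gamma (rmin mu))
       (fun mu : R => nu `^ (- (nu / (nu + 1))) * (a * kappa) `^ (1 / (nu + 1))
                        * mu `^ (nu / (nu + 1)))) /\
  (forall r1 r2 : R -> R,
     minimizer_family phi L a r1 -> minimizer_family phi L a r2 ->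
     asymp_equiv 0^'+ r1 r2).
Proof.
have d_gt0 := defect_gt0 phi_convex phi_gamma phi_neq.
have c_gt0 : 0 < a * nu * kappa by rewrite !mulr_gt0.
have radius := minimizer_scaled_cvg phi_convex nu_gt0 kappa_gt0 a_gt0 d_asymp.
split=> //; split; [|split].
- move=> mu mu0.
  (* The Lipschitz constant adds those of [a * phi] and of the linear term. Beyond the radius
     [a * d(0) / mu], the term [mu * r] alone outweighs [a * d(0)]. *)
  apply: (@lipschitz_minimizer_exists _ _ (a * L + `|a * L - mu|)
    (a * defect phi L gamma 0 / mu)).
  + move=> x y x0 xy.
    have h1 : phi x <= phi y.
      by apply: phi_nondecr => //; rewrite inE halflineE//; exact: le_trans xy.
    have h2 : phi y - phi x <= L * (y - x).
      have := defect_nonincr phi_convex phi_gamma x0 xy.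
      by rewrite /defect; lra.
    rewrite /tilted.
    have -> : a * phi x - (a * L - mu) * x - (a * phi y - (a * L - mu) * y) =
      a * (phi x - phi y) + (a * L - mu) * (y - x) by ring.
    apply: (le_trans (ler_normD _ _)).
    rewrite !normrM (gtr0_norm a_gt0) distrC mulrDl.
    rewrite (ger0_norm (_ : 0 <= phi y - phi x)) ?subr_ge0//.
    rewrite (ger0_norm (_ : 0 <= y - x)) ?subr_ge0//.
    by rewrite lerD2r -mulrA ler_pM2l.
  + by rewrite divr_ge0 ?mulr_ge0 ?ltW// d_gt0.
  + move=> r; rewrite ler_pdivrMr// => hr.
    have r0 : 0 <= r.
      by rewrite -(pmulr_lge0 r mu0) (le_trans _ hr)// mulr_ge0 ?ltW// d_gt0.
    rewrite !(tiltedE _ _ gamma).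
    by have := mulr_gt0 a_gt0 (d_gt0 r r0); lra.
- move=> rmin rP; split; first exact: radius.
  split.
    apply: (asymp_equiv_of_ratio _ _ (minimizer_value_cvg phi_convex nu_gt0
      kappa_gt0 a_gt0 d_asymp rP)).
      by rewrite gt_eqF// addr_gt0 ?invr_gt0.
    near=> mu; have mu0 : 0 < mu by near: mu; exact: nbhs_right_gt.
    (* Without its factor [nu + 1], the target is [nu^-1 * (mu * s)], and
       [(nu + 1) / nu = nu^-1 + 1]. *)
    rewrite /Cnu -[LHS]mulrA -[LHS]mulrA [X in (nu + 1) * X]mulrA.
    rewrite radius_scale_constant//=.
    by field; rewrite gt_eqF.
  apply: (asymp_equiv_of_ratio _ _ (minimizer_defect_cvg phi_convex nu_gt0
    kappa_gt0 a_gt0 d_asymp rP)); first by rewrite gt_eqF// invr_gt0.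
  near=> mu; have mu0 : 0 < mu by near: mu; exact: nbhs_right_gt.
  exact: radius_scale_constant.
- move=> r1 r2 /radius h1 /radius h2; rewrite /asymp_equiv.
  rewrite -[X in _ --> X](divr1 1).
  (* Both families are compared with the same scale, which cancels in the quotient because it is
     positive. *)
  apply: cvg_trans (cvgM h1 (cvgV (oner_neq0 R) h2)).
  apply: near_eq_cvg; near=> mu => /=.
  have mu0 : 0 < mu by near: mu; exact: nbhs_right_gt.
  have s0 : 0 < radius_scale nu (a * nu * kappa) mu.
    by rewrite powR_gt0 ?divr_gt0.
  by rewrite invfM invrK mulrACA mulVf ?mulr1// gt_eqF.
Unshelve. all: by end_near. Qed.
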